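(* For $p>0$ let $\mathcal{S}_p=\{x^{-p}e^{ix} : 1<x<\infty\}\subset\mathbb{C}=\mathbb{R}^2$. For $p\in(0,1)$ and $\theta\in(0,1)$, $$\dim_{\mathrm A}^\theta\mathcal{S}_p=\min\left\{\frac{2}{(1+p)(1-\theta)},\,2\right\},$$ and for $p\geq1$ and $\theta\in(0,1)$, $$\dim_{\mathrm A}^\theta\mathcal{S}_p=\min\left\{1+\frac{\theta}{p(1-\theta)},\,2\right\}.$$ In both cases the function $\theta\mapsto\dim_{\mathrm A}^\theta\mathcal{S}_p$ on $(0,1)$ has a single phase transition (point of non-differentiability), at $\theta=\frac{p}{1+p}$. Moreover, if $p>1$, then for all $0<\theta<\frac{p}{1+p}$, $$\dim_{\mathrm A}^\theta\mathcal{S}_p<\min\left\{\frac{\overline{\dim}_{\mathrm B}\mathcal{S}_p}{1-\theta},\,\dim_{\mathrm{qA}}\mathcal{S}_p\right\}.$$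
   Context: For a non-empty bounded set $F\subset\mathbb{R}^d$ and $r>0$, $N_r(F)$ is the smallest number of sets of diameter at most $r$ needed to cover $F$. The upper box dimension is $\overline{\dim}_{\mathrm B}F=\limsup_{r\to0}\frac{\log N_r(F)}{-\log r}$. For $\theta\in(0,1)$, the Assouad spectrum of $F$ at $\theta$ is $$\dim_{\mathrm A}^\theta F=\inf\left\{\alpha\geq 0:\ \exists C>0\ \forall\, 0<r<1\ \forall x\in F,\ N_r\big(B(x,r^\theta)\cap F\big)\leq C\left(\frac{r^\theta}{r}\right)^\alpha\right\},$$ where $B(x,R)$ is the ball of centre $x$ and radius $R$. The quasi-Assouad dimension is $\dim_{\mathrm{qA}}F=\lim_{\theta\to1}\dim_{\mathrm A}^\theta F$ (the limit exists). It is known that $\overline{\dim}_{\mathrm B}F\leq\dim_{\mathrm A}^\theta F\leq\min\left\{\frac{\overline{\dim}_{\mathrm B}F}{1-\theta},\dim_{\mathrm{qA}}F\right\}$ for every bounded $F$. *)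

(* Defs.v *)
From mathcomp Require Import all_boot all_order all_algebra.
From mathcomp Require Import all_classical all_reals all_analysis.
From mathcomp Require Import complex.

Set Implicit Arguments.
Unset Strict Implicit.
Unset Printing Implicit Defensive.

Import Order.TTheory GRing.Theory Num.Theory.
Import numFieldNormedType.Exports.

Local Open Scope classical_set_scope.
Local Open Scope ring_scope.
Local Open Scope complex_scope.

(* The plane is R[i]. Its MathComp norm `|z| takes values in R[i], so distances
   are expressed with the R-valued modulus normc, i.e. the Euclidean norm of
   R^2 (and not the sup norm of R * R). *)

Section BoxCounting.
Context {R : realType}.
Local Notation C := R[i].
Implicit Types (F U : set C) (x : C) (r theta p : R).

(* Closed balls. *)
Definition cball x r : set C := [set y | Normc.normc (y - x) <= r].

(* The empty set has diameter -oo, hence is an admissible covering set. *)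
Definition diam U : \bar R :=
  ereal_sup [set (Normc.normc (x - y))%:E | x in U & y in U].

Definition coverable F r (n : nat) : Prop :=
  exists U : nat -> set C,
    (forall i, (i < n)%N -> (diam (U i) <= r%:E)%E) /\
    F `<=` \bigcup_(i < n) U i.

(* A minimum whenever F is bounded and 0 < r; +oo if there is no finite cover. *)
Definition covering_number r F : \bar R :=
  ereal_inf [set (n%:R : R)%:E | n in coverable F r].

Definition upper_box_dim F : \bar R :=
  limf_esup (fun r => lne (covering_number r F) * ((- ln r)^-1)%:E)%E 0^'+.

Definition assouad_spectrum theta F : \bar R :=
  ereal_inf [set a%:E | a in [set a : R | 0 <= a /\
    exists2 c : R, 0 < c & forall r x, 0 < r < 1 -> F x ->
      (covering_number r (cball x (r `^ theta) `&` F)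
         <= (c * ((r `^ theta) / r) `^ a)%:E)%E]].

Definition quasi_assouad_dim F : \bar R :=
  lim (assouad_spectrum theta F @[theta --> (1 : R)^'-]).

(* x^-p * exp (i x), with exp (i x) = cos x + i sin x *)
Definition spiral p : set C :=
  [set (x `^ (- p))%:C * (cos x +i* sin x) | x in [set x : R | 1 < x]].

(* The \bar R-valued spectrum is read back in R by fine to be differentiated. *)
Definition phase_transitions F : set R :=
  [set theta | 0 < theta < 1 /\
     ~ derivable (fun t : R => fine (assouad_spectrum t F)) theta 1].

End BoxCounting.

(* Main.v *)
Require Import Defs.
From mathcomp Require Import all_boot all_order all_algebra.
From mathcomp Require Import all_classical all_reals all_analysis.
From mathcomp Require Import complex.
From mathcomp Require Import ring lra.

(* Write g(x) = x^-p e^(ix). For s >= 1 - p, s <> 0, the curve g is Lipschitz as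
   a function of x^s, so that arcs of the spiral are covered at scale r by about
   (their variation of x^s) / r sets.
   Upper bounds: 2 is the bound for planar sets. For p <= 1 it suffices to cover
   the whole spiral: the arc x <= T := r^(-1/(1+p)) along its length and the
   rest as a planar set inside the disc of radius T^-p. For p > 1 a ball of
   radius R only sees moduli x^-p in an interval of length 2R, on which
   x^(1-p) varies by at most (2R)^(1-1/p).
   Lower bounds: the turns with parameters in [X, C X] have length about X^-p and
   lie at distance about X^(-p-1) from each other. Keeping every M-th of them, M
   about 1 + r X^(p+1), gives about X^(1-p) / (r (1 + r X^(p+1))) points at
   mutual distance > r in the ball B(g(X), 2 X^-p). The three lower bounds come
   from X = K r^-eta with eta = theta/p or eta = 1/(1+p). *)

Set Implicit Arguments.
Unset Strict Implicit.
Unset Printing Implicit Defensive.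

Import Order.TTheory GRing.Theory Num.Theory.
Import numFieldNormedType.Exports.

Local Open Scope classical_set_scope.
Local Open Scope ring_scope.

(** * Covers of Lipschitz images and of discs; separated points *)

Section Covering.
Context {R : realType}.
Local Notation C := R[i].
Implicit Types (F G U : set C) (z : C) (r : R).

Lemma normc_Re_le z : `|complex.Re z| <= Normc.normc z.
Proof.
case: z => a b /=; rewrite -sqrtr_sqr ler_wsqrtr// lerDl; exact: sqr_ge0.
Qed.

Lemma normc_Im_le z : `|complex.Im z| <= Normc.normc z.
Proof.
case: z => a b /=; rewrite -sqrtr_sqr ler_wsqrtr// lerDr; exact: sqr_ge0.
Qed.

Lemma normc_le_ReIm z : Normc.normc z <= `|complex.Re z| + `|complex.Im z|.
Proof.
case: z => a b /=; rewrite -[leRHS]ger0_norm ?addr_ge0// -sqrtr_sqr.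
apply: ler_wsqrtr; rewrite sqrrD !real_normK ?num_real// lerD2r lerDl.
by rewrite mulrn_wge0// mulr_ge0.
Qed.

Lemma diam_le U r :
  (forall x y, U x -> U y -> Normc.normc (x - y) <= r) -> (diam U <= r%:E)%E.
Proof.
move=> Ur; apply: ge_ereal_sup => _ [x Ux [y Uy <-]].
by rewrite lee_fin Ur.
Qed.

Lemma normc_le_diam U r x y :
  (diam U <= r%:E)%E -> U x -> U y -> Normc.normc (x - y) <= r.
Proof.
move=> Ur Ux Uy; rewrite -lee_fin; apply: le_trans Ur.
by apply: ereal_sup_ubound; exists x => //; exists y.
Qed.

Lemma covering_number_le F r n :
  coverable F r n -> (covering_number r F <= n%:R%:E)%E.
Proof. by move=> Fn; apply: ereal_inf_lbound; exists n. Qed.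

Lemma covering_number_ge F r (b : \bar R) :
  (forall n, coverable F r n -> (b <= n%:R%:E)%E) -> (b <= covering_number r F)%E.
Proof. by move=> Fb; apply: le_ereal_inf_tmp => _ [n /Fb ? <-]. Qed.

Lemma coverableS F G r n : F `<=` G -> coverable G r n -> coverable F r n.
Proof. by move=> FG [U [Ud GU]]; exists U; split=> //; apply: subset_trans GU. Qed.

Lemma coverableU F G r m n :
  coverable F r m -> coverable G r n -> coverable (F `|` G) r (m + n).
Proof.
move=> [U [Ud FU]] [V [Vd GV]].
exists (fun i => if (i < m)%N then U i else V (i - m)%N); split.
  move=> i imn; case: ifPn => [/Ud//|]; rewrite -leqNgt => mi.
  by apply: Vd; rewrite ltn_subLR.
move=> z [/FU|/GV] [i /= il zi]; first by exists i; rewrite /= ?ltn_addr ?il.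
by exists (m + i)%N; rewrite /= ?ltn_add2l// ltnNge leq_addr/= addKn.
Qed.

(* Pull back a partition of the range of g into intervals of length r / K. *)
Lemma coverable_lipschitz T (f : T -> C) (g : T -> R) (A : set T) (K u v : R) r :
    0 < K -> 0 < r -> u <= v ->
    (forall x, A x -> u <= g x <= v) ->
    (forall x y, A x -> A y -> Normc.normc (f x - f y) <= K * `|g x - g y|) ->
  exists2 n, coverable (f @` A) r n & n%:R <= K * (v - u) / r + 1.
Proof.
move=> K0 r0 uv guv fg; pose w := r / K.
have w0 : 0 < w by rewrite divr_gt0.
(* The successor counts the cell that contains the endpoint [v]. *)
pose n := (Num.truncn ((v - u) / w)).+1.
exists n; last first.
  rewrite /n -natr1 lerD2r (_ : _ / r = (v - u) / w); last first.
    by rewrite /w invf_div; field; rewrite !gt_eqF.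
  by rewrite truncn_le divr_ge0 ?subr_ge0// ltW.
exists (fun i => f @` (A `&` [set x | Num.truncn ((g x - u) / w) = i])); split.
- move=> i _; apply: diam_le => _ _ [x [Ax /= xi] <-] [y [Ay /= yi] <-].
  apply: (le_trans (fg _ _ Ax Ay)); rewrite mulrC -ler_pdivlMr// -/w.
  have : 0 <= (g x - u) / w.
    by apply: divr_ge0; rewrite ?(ltW w0)// subr_ge0; case/andP: (guv _ Ax).
  have : 0 <= (g y - u) / w.
    by apply: divr_ge0; rewrite ?(ltW w0)// subr_ge0; case/andP: (guv _ Ay).
  move=> /truncn_itv/andP[y1 y2] /truncn_itv/andP[x1 x2].
  rewrite xi -natr1 ler_pdivlMr// ltr_pdivrMr// in x1 x2.
  rewrite yi -natr1 ler_pdivlMr// ltr_pdivrMr// in y1 y2.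
  by rewrite ler_norml; apply/andP; split; lra.
- move=> _ [x Ax <-]; exists (Num.truncn ((g x - u) / w)); last by exists x.
  rewrite /= ltnS le_truncn// ler_pM2r ?invr_gt0// lerD2r.
  by case/andP: (guv _ Ax).
Qed.

(** A grid of squares of side [r / 2] does it: the distance of two points is at most the sum of
    their coordinate distances, so a square has diameter at most [r]. *)
Lemma coverable_cball z (rho r : R) : 0 <= rho -> 0 < r ->
  exists2 n, coverable (cball z rho) r n & n%:R <= (4 * rho / r + 1) ^+ 2.
Proof.
move=> rho0 r0; pose w := r / 2.
have w0 : 0 < w by rewrite divr_gt0.
pose m := (Num.truncn ((2 * rho) / w)).+1.
have m0 : (0 < m)%N by [].
pose k (t : R) := Num.truncn ((t + rho) / w).
have km t : `|t| <= rho -> (k t < m)%N.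
  rewrite ler_norml => /andP[t1 t2].
  by rewrite /= ltnS le_truncn// ler_pM2r ?invr_gt0//; lra.
have kd s t : `|s| <= rho -> `|t| <= rho -> k s = k t -> `|s - t| <= w.
  rewrite !ler_norml => /andP[s1 s2] /andP[t1 t2] st.
  have : 0 <= (s + rho) / w by apply: divr_ge0; lra.
  have : 0 <= (t + rho) / w by apply: divr_ge0; lra.
  move=> /truncn_itv/andP[y1 y2] /truncn_itv/andP[x1 x2].
  rewrite -/(k s) st -natr1 ler_pdivlMr// ltr_pdivrMr// in x1 x2.
  rewrite -/(k t) -natr1 ler_pdivlMr// ltr_pdivrMr// in y1 y2.
  by apply/andP; split; lra.
exists (m * m)%N; last first.
  rewrite natrM expr2; have : m%:R <= 4 * rho / r + 1.
    rewrite /m -natr1 lerD2r (_ : 4 * rho / r = 2 * rho / w); last first.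
      by rewrite /w; field; rewrite !gt_eqF.
    by rewrite truncn_le divr_ge0 ?mulr_ge0// ltW.
  by move=> ?; rewrite ler_pM.
(* The index [i] encodes the square in row [i %/ m] and column [i %% m]. *)
exists (fun i => [set y | [/\ Normc.normc (y - z) <= rho,
   k (complex.Re (y - z)) = (i %/ m)%N & k (complex.Im (y - z)) = (i %% m)%N]]).
split.
- move=> i _; apply: diam_le => x y [xr x1 x2] [yr y1 y2].
  rewrite (_ : x - y = (x - z) - (y - z)); last by rewrite opprB addrA subrK.
  move: (x - z) (y - z) xr x1 x2 yr y1 y2 => a b ar a1 a2 br b1 b2.
  apply: (le_trans (normc_le_ReIm _)).
  rewrite (_ : r = w + w); last by rewrite /w; lra.
  rewrite !raddfB/=; apply: lerD; apply: kd; rewrite ?a1 ?a2//.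
  + exact: le_trans (normc_Re_le _) ar.
  + exact: le_trans (normc_Re_le _) br.
  + exact: le_trans (normc_Im_le _) ar.
  + exact: le_trans (normc_Im_le _) br.
- move=> y /= yr; have h1 := km _ (le_trans (normc_Re_le _) yr).
  have h2 := km _ (le_trans (normc_Im_le _) yr).
  exists (k (complex.Re (y - z)%R) * m + k (complex.Im (y - z)%R))%N => /=.
    by rewrite -ltn_divLR// divnMDl// divn_small// addn0.
  by rewrite divnMDl// modnMDl divn_small ?modn_small ?addn0.
Qed.

(** Pigeonhole: a set of diameter at most [r] holds at most one of the points. *)
Lemma card_separated_le (T : finType) (s : T -> C) F r n :
    (forall i, F (s i)) ->
    (forall i j, i != j -> r < Normc.normc (s i - s j)) ->
  coverable F r n -> (#|T| <= n)%N.
Proof.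
move=> Fs sep [U [Ud FU]].
have /choice[k kP] (i : T) : exists k : 'I_n, U k (s i).
  by have [k /= kn Uk] := FU _ (Fs i); exists (Ordinal kn).
rewrite -[n]card_ord; apply: (leq_card k) => i j kij.
apply: contrapT => /eqP /sep; apply/negP; rewrite -leNgt.
apply: (normc_le_diam (Ud (k i) (ltn_ord _)) (kP i)).
by rewrite kij; exact: kP.
Qed.

End Covering.

(** * Power and sine inequalities, and distances along the spiral *)

Section RealAnalysis.
Context {R : realType}.
Implicit Types (f g : R -> R) (p s x y : R).

Lemma is_derive_within_continuous f (df : R -> R) (a b : R) :
    (forall x, a <= x <= b -> is_derive x 1 f (df x)) ->
  {within `[a, b], continuous f}.
Proof.
move=> fdf; apply: derivable_within_continuous => x.
by rewrite in_itv/= => /fdf [].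
Qed.

(** The mean value theorem applies to [g + f] and [g - f], whose derivatives are nonnegative; this
    replaces integration of the speed. *)
Lemma ler_norm_increment f g (df dg : R -> R) (a b : R) :
    a <= b ->
    (forall x, a <= x <= b -> is_derive x 1 f (df x)) ->
    (forall x, a <= x <= b -> is_derive x 1 g (dg x)) ->
    (forall x, a <= x <= b -> `|df x| <= dg x) ->
  `|f b - f a| <= g b - g a.
Proof.
move=> ab fdf gdg fg.
have dD x : a <= x <= b -> is_derive x 1 (g + f) (dg x + df x).
  by move=> xab; apply: is_deriveD; [exact: gdg|exact: fdf].
have dB x : a <= x <= b -> is_derive x 1 (g - f) (dg x - df x).
  by move=> xab; apply: is_deriveB; [exact: gdg|exact: fdf].
have oc x : x \in `]a, b[ -> a <= x <= b.
  by rewrite in_itv/= => /andP[/ltW-> /ltW->].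
have [c + cE] := MVT_segment ab (fun x xab => dD x (oc x xab))
  (is_derive_within_continuous dD).
have [d + dE] := MVT_segment ab (fun x xab => dB x (oc x xab))
  (is_derive_within_continuous dB).
rewrite !in_itv/= => /fg + /fg; rewrite !ler_norml => /andP[d1 d2] /andP[c1 c2].
have h1 : 0 <= (g + f) b - (g + f) a by rewrite cE mulr_ge0; lra.
have h2 : 0 <= (g - f) b - (g - f) a by rewrite dE mulr_ge0; lra.
move: h1 h2; rewrite /= => h1 h2; apply/andP; split.
  have : (g + f) b - (g + f) a = (g b + f b) - (g a + f a) by []; lra.
have : (g - f) b - (g - f) a = (g b - f b) - (g a - f a) by []; lra.
Qed.

Lemma ler_powR_npos s x y : s <= 0 -> 0 < x -> x <= y -> y `^ s <= x `^ s.
Proof.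
move=> s0 x0 xy; have y0 : 0 < y by exact: lt_le_trans xy.
rewrite -[s]opprK !(powRN _ (- s)) lef_pV2 ?posrE ?powR_gt0//.
by apply: ge0_ler_powR; rewrite ?oppr_ge0 ?nnegrE ?(ltW x0) ?(ltW y0).
Qed.

Lemma is_derive_mull (c x : R) : is_derive x 1 (fun t : R => c * t) c.
Proof.
have := @is_deriveZ _ _ _ (@id R) c x 1 1 (is_derive_id _ _).
by rewrite /GRing.scale/= mulr1.
Qed.

(** On [[x, y]] the power t^-p decreases at least as fast as at the right end [y]. This measures the
    gap between turns. *)
Lemma powRN_decrement p x y : 0 < p -> 0 < x -> x <= y ->
  p * y `^ (- p - 1) * (y - x) <= x `^ (- p) - y `^ (- p).
Proof.
move=> p0 x0 xy; set c := p * y `^ (- p - 1).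
have c0 : 0 <= c by rewrite mulr_ge0 ?powR_ge0 ?ltW.
have dg z : x <= z <= y ->
    is_derive z 1 (- (fun t : R => t `^ (- p))) (- (- p * z `^ (- p - 1))).
  move=> /andP[xz _]; apply: is_deriveN.
  by apply: is_derive1_powR; exact: lt_le_trans xz.
have := @ler_norm_increment (fun t => c * t) _ (fun=> c) _ _ _ xy
  (fun z _ => is_derive_mull c z) dg.
rewrite -mulrBr (ger0_norm c0) ger0_norm; last first.
  by apply: (mulr_ge0 c0); rewrite subr_ge0.
move=> H.
rewrite (_ : x `^ (- p) - y `^ (- p) = - y `^ (- p) - - x `^ (- p)); last by ring.
apply: H => z /andP[xz zy].
rewrite mulNr opprK ler_wpM2l ?(ltW p0)//.
by apply: ler_powR_npos => //; [lra|exact: lt_le_trans xz].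
Qed.

(** The shares x/(x+y) and y/(x+y) lie in [0, 1], so each is at most its [s]-th power, and they add
    up to 1. *)
Lemma powR_subadditive s x y : 0 < s <= 1 -> 0 <= x -> 0 <= y ->
  (x + y) `^ s <= x `^ s + y `^ s.
Proof.
move=> /andP[s0 s1] x0 y0.
have [xy0|xy0] := leP (x + y) 0.
  have -> : x = 0 by lra.
  have -> : y = 0 by lra.
  by rewrite add0r lerDl powR_ge0.
have H t : 0 <= t -> t <= x + y -> t / (x + y) * (x + y) `^ s <= t `^ s.
  move=> t0 txy; rewrite -{2}(divfK (lt0r_neq0 xy0) t) powRM ?divr_ge0 ?(ltW xy0)//.
  rewrite ler_wpM2r ?powR_ge0//; have [->|t1] := eqVneq t 0.
    by rewrite mul0r powR_ge0.
  have t2 : 0 < t by rewrite lt_def t1.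
  apply: ger1_powR => //; apply/andP; split; first exact: divr_gt0.
  by rewrite ler_pdivrMr ?mul1r.
have := lerD (H x x0 _) (H y y0 _).
by rewrite -mulrDl -mulrDl divff ?gt_eqF// mul1r; apply; rewrite ?lerDl ?lerDr.
Qed.

(* The constant cos 1 avoids any numerical bound on sin or pi. *)
Lemma cos1_mul_le_sin x : 0 <= x <= 1 -> cos 1 * x <= sin x.
Proof.
move=> /andP[x0 x1]; have pi2 := pi_ge2 R.
have c0 (z : R) : 0 <= z <= 1 -> cos 1 <= cos z.
  move=> /andP[z0 z1].
  have h1 : (1 : R) \in `[0, pi] by rewrite in_itv/=; apply/andP; split; lra.
  have hz : z \in `[0, pi] by rewrite in_itv/=; apply/andP; split; lra.
  by rewrite leNgt ltr_cos// -leNgt.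
have c1 := cos1_gt0 R.
have := @ler_norm_increment (fun t => cos 1 * t) sin (fun=> cos 1) cos _ _ x0
  (fun z _ => is_derive_mull _ z) (fun z _ => is_derive_sin z).
rewrite sin0 !subr0 mulr0 subr0 => H.
apply: le_trans (H _); first exact: ler_norm.
move=> z /andP[z0 zx]; rewrite ger0_norm ?(ltW c1)// c0// z0/=.
exact: le_trans x1.
Qed.

(** Written by real coordinates, so that each can be differentiated as a real function. *)
Definition spiral_pt p x : R[i] :=
  (x `^ (- p) * cos x +i* (x `^ (- p) * sin x))%C.

Lemma spiralE p : spiral p = spiral_pt p @` [set x | 1 < x].
Proof.
by apply/eq_imagel => x _; rewrite /spiral_pt; simpc.
Qed.

Lemma normc_spiral_pt p x : Normc.normc (spiral_pt p x) = x `^ (- p).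
Proof.
rewrite /= !exprMn -mulrDr cos2Dsin2 mulr1 sqrtr_sqr ger0_norm//.
exact: powR_ge0.
Qed.

(* K x^s / s dominates the variation of both coordinates, because the speed of
   the spiral is at most (1 + p) x^-p <= (1 + p) x^(s-1). *)
Lemma spiral_pt_lipschitz p s : 0 < p -> 1 - p <= s -> s != 0 ->
  exists2 K, 0 < K & forall x y, 1 <= x -> 1 <= y ->
    Normc.normc (spiral_pt p x - spiral_pt p y) <= K * `|x `^ s - y `^ s|.
Proof.
move=> p0 ps s0; pose K := (1 + p) / `|s|.
have K0 : 0 < K by rewrite divr_gt0 ?normr_gt0//; lra.
have dom x y (f : R -> R) (df : R -> R) : 1 <= x -> x <= y ->
    (forall z : R, 1 <= z -> is_derive z 1 f (df z)) ->
    (forall z : R, 1 <= z -> `|df z| <= (1 + p) * z `^ (- p)) ->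
    `|f y - f x| <= K * `|x `^ s - y `^ s|.
  move=> x1 xy fdf fp.
  (* Dividing by [s] with its sign makes [g] increasing for negative [s] too: its derivative is (1 +
     p) t^(s-1). *)
  pose g := fun t : R => (1 + p) / s * (t `^ s).
  apply: (@le_trans _ _ (g y - g x)); last first.
    rewrite /g -mulrBr distrC /K -[`|s|^-1]normfV -[in leRHS](@ger0_norm _ (1 + p)); last lra.
    by rewrite -!normrM ler_norm.
  have z1 (z : R) : x <= z <= y -> 1 <= z by move=> /andP[+ _]; exact: le_trans.
  apply: (ler_norm_increment xy (fun z xz => fdf z (z1 z xz))
    (dg := fun z => (1 + p) / s * (s * z `^ (s - 1)))).
    move=> z /z1 zz.
    apply: (@is_deriveZ _ _ _ (fun t : R => t `^ s) ((1 + p) / s)).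
    by apply: is_derive1_powR; exact: lt_le_trans zz.
  move=> z /z1 zz; apply: (le_trans (fp z zz)).
  rewrite mulrA divfK// ler_wpM2l//; first lra.
  by apply: ler_powR => //; lra.
have dpow (z : R) : 1 <= z -> is_derive z 1 (fun t : R => t `^ (- p)) (- p * z `^ (- p - 1)).
  by move=> z1; apply: is_derive1_powR; exact: lt_le_trans z1.
have bnd (z : R) (a b : R) : 1 <= z -> `|a| <= 1 -> `|b| <= 1 ->
    `|z `^ (- p) * a + b * (- p * z `^ (- p - 1))| <= (1 + p) * z `^ (- p).
  move=> z1 a1 b1; apply: (le_trans (ler_normD _ _)); rewrite mulrDl mul1r.
  apply: lerD.
    by rewrite normrM (ger0_norm (powR_ge0 _ _)) ler_piMr ?powR_ge0.
  rewrite normrM normrM normrN (gtr0_norm p0) (ger0_norm (powR_ge0 _ _)).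
  rewrite -[leRHS]mul1r ler_pM ?mulr_ge0 ?powR_ge0 ?(ltW p0)//.
  by rewrite ler_wpM2l ?(ltW p0)// ler_powR//; lra.
have dre (z : R) : 1 <= z -> is_derive z 1 (fun t : R => t `^ (- p) * cos t)
    (z `^ (- p) * (- sin z) + cos z * (- p * z `^ (- p - 1))).
  by move=> /dpow h; exact: (@is_deriveM _ _ (fun t : R => t `^ (- p)) cos z).
have dim (z : R) : 1 <= z -> is_derive z 1 (fun t : R => t `^ (- p) * sin t)
    (z `^ (- p) * cos z + sin z * (- p * z `^ (- p - 1))).
  by move=> /dpow h; exact: (@is_deriveM _ _ (fun t : R => t `^ (- p)) sin z).
have cos1 (z : R) : `|cos z| <= 1 by rewrite ler_norml cos_geN1 cos_le1.
have sin1 (z : R) : `|sin z| <= 1 by rewrite ler_norml sin_geN1 sin_le1.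
exists (K + K); first by rewrite addr_gt0.
suff main x y : 1 <= x -> x <= y ->
    Normc.normc (spiral_pt p y - spiral_pt p x) <= (K + K) * `|x `^ s - y `^ s|.
  move=> x y x1 y1; have [yx|/ltW xy] := leP y x.
    by rewrite distrC; exact: main.
  by rewrite -opprB normcN; exact: main.
move=> x1 xy; apply: (le_trans (normc_le_ReIm _)); rewrite mulrDl; apply: lerD.
  by apply: (dom _ _ _ _ x1 xy dre) => z z1; apply: bnd => //; rewrite normrN.
by apply: (dom _ _ _ _ x1 xy dim) => z z1; apply: bnd.
Qed.

(** The left side is the component of the difference along a unit normal to e^(ix), the direction of
    [spiral_pt p x], which itself contributes nothing to it. *)
Lemma sin_dist_le_spiral_pt p x y :
  y `^ (- p) * sin (y - x) <= Normc.normc (spiral_pt p x - spiral_pt p y).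
Proof.
rewrite /=; set a := x `^ _; set b := y `^ _.
set u := a * cos x - b * cos y; set v := a * sin x - b * sin y.
have -> : b * sin (y - x) = sin x * u - cos x * v.
  by rewrite sinB /u /v; ring.
apply: (le_trans (ler_norm _)); rewrite -sqrtr_sqr ler_wsqrtr//.
(* Rotating by the angle -x preserves the norm. *)
have -> : u ^+ 2 + v ^+ 2 = (sin x * u - cos x * v) ^+ 2 + (cos x * u + sin x * v) ^+ 2.
  rewrite -[LHS]mul1r -(cos2Dsin2 x); ring.
by rewrite lerDl sqr_ge0.
Qed.

End RealAnalysis.

(** * Upper bounds for covering numbers of the spiral *)

Section SpiralCounting.
Context {R : realType}.
Implicit Types (p s r rho x X : R).

Lemma powR_ge1 x s : 1 <= x -> 0 <= s -> 1 <= x `^ s.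
Proof. by move=> x1 s0; rewrite -(powRr0 x) ler_powR. Qed.

(* The arc x <= T := r^(-1/(1+p)) is covered along its length, and the part
   winding inside the disc of radius T^-p as a planar set; at this T the two
   counts balance. *)
Lemma coverable_spiral p s : 0 < p -> 1 - p <= s -> 0 < s ->
  exists2 K, 0 < K & forall r, 0 < r < 1 ->
    exists2 n, coverable (spiral p) r n &
      n%:R <= K * r `^ (- ((1 + s + p) / (1 + p))).
Proof.
move=> p0 ps s0; have [K K0 lip] := spiral_pt_lipschitz p0 ps (lt0r_neq0 s0).
(* [K] comes from the arc, 25 from (4T + 1)^2 <= 25 T^2 for the disc, and 1 absorbs the additive 1
   in the count of the arc. *)
exists (K + 26); first by lra.
move=> r /andP[r0 r1]; pose T := r `^ (- (1 + p)^-1).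
have p1 : 0 < 1 + p by lra.
have T0 : 0 < T by exact: powR_gt0.
have T1 : 1 <= T.
  rewrite /T -[leLHS](powRr0 r); apply: ger_powR; first by rewrite r0 ltW.
  by rewrite oppr_le0 invr_ge0 ltW.
have rT : r^-1 = T `^ (1 + p).
  by rewrite -powRrM mulNr mulVf ?gt_eqF// powR_inv1 ?ltW.
have -> : r `^ (- ((1 + s + p) / (1 + p))) = T `^ (1 + s + p).
  by rewrite -powRrM; congr (_ `^ _); field; rewrite gt_eqF.
have [|x y /= /andP[x1 _] /andP[y1 _]|n1 cov1 n1le] :=
  @coverable_lipschitz R R (spiral_pt p) (fun x => x `^ s)
  [set x | 1 < x <= T] K 1 (T `^ s) r K0 r0 (powR_ge1 T1 (ltW s0)).
- move=> x /= /andP[x1 xT]; rewrite powR_ge1 ?(ltW x1) ?(ltW s0)//=.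
  by apply: ge0_ler_powR; rewrite ?nnegrE ?(ltW s0) ?(ltW T0)//; lra.
- by apply: lip; exact: ltW.
have [n2 cov2 n2le] := coverable_cball 0 (powR_ge0 T (- p)) r0.
exists (n1 + n2)%N.
  apply: coverableS (coverableU cov1 cov2); rewrite spiralE => _ [x /= x1 <-].
  have [xT|/ltW Tx] := leP x T; [left; exists x => //=; exact/andP|right].
  by rewrite /cball /mkset subr0 normc_spiral_pt ler_powR_npos// oppr_le0 ltW.
have E1 : T `^ s * r^-1 = T `^ (1 + s + p).
  rewrite rT -powRD; last by rewrite (gt_eqF T0) implybT.
  by congr (_ `^ _); ring.
have E2 : T `^ (- p) * r^-1 = T.
  rewrite rT -powRD; last by rewrite (gt_eqF T0) implybT.
  by rewrite (_ : - p + (1 + p) = 1) ?powRr1 ?ltW//; ring.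
have T2 : T ^+ 2 <= T `^ (1 + s + p).
  by rewrite -powR_mulrn ?(ltW T0)// ler_powR//; lra.
have TT : 1 <= T `^ (1 + s + p) by apply: powR_ge1 => //; lra.
have ri : 0 < r^-1 by rewrite invr_gt0.
rewrite natrD mulrDl; apply: le_trans (lerD n1le n2le) _.
rewrite -[4 * _ / r]mulrA E2 -mulrA mulrBl E1 mul1r.
have : (4 * T + 1) ^+ 2 <= 25 * T ^+ 2 by rewrite -subr_ge0; nra.
have : K * (T `^ (1 + s + p) - r^-1) <= K * T `^ (1 + s + p).
  by rewrite ler_wpM2l ?(ltW K0)//; lra.
lra.
Qed.

(* In terms of the modulus a = x^-p, the spiral is Lipschitz in a^(1 - 1/p),
   which is itself (1 - 1/p)-Hoelder in a; a ball only sees an interval of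
   moduli of length 2 rho. *)
Lemma coverable_cball_spiral p : 1 < p ->
  exists2 K, 0 < K & forall r rho z, 0 < r -> 0 <= rho -> spiral p z ->
    exists2 n, coverable (cball z rho `&` spiral p) r n &
      n%:R <= K * rho `^ (1 - p^-1) / r + 1.
Proof.
move=> p1; have p0 : 0 < p by lra.
have s0 : 1 - p != 0 by rewrite subr_eq0 lt_eqF.
have [K K0 lip] := spiral_pt_lipschitz p0 (lexx _) s0.
pose t := 1 - p^-1.
have pV : p^-1 < 1 by rewrite invf_lt1.
have pV0 : 0 < p^-1 by rewrite invr_gt0.
have t0 : 0 < t by rewrite subr_gt0.
exists (K * 2 `^ t); first by rewrite mulr_gt0 ?powR_gt0.
move=> r rho z r0 rho0; rewrite spiralE => -[x0 /= x01 zE].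
pose a0 := x0 `^ (- p).
have a00 : 0 <= a0 by exact: powR_ge0.
(* The ball may reach the origin, making [a0 - rho] negative; the moduli then start at 0, where the
   power is still monotone. *)
pose b := Num.max 0 (a0 - rho).
have b0 : 0 <= b by rewrite le_max lexx.
have bl : a0 - rho <= b by rewrite le_max lexx orbT.
have ba : b <= a0 + rho by rewrite ge_max; apply/andP; split; lra.
have uv : b `^ t <= (a0 + rho) `^ t.
  by apply: ge0_ler_powR; rewrite ?nnegrE ?(ltW t0)//; lra.
have vu : (a0 + rho) `^ t - b `^ t <= 2 `^ t * rho `^ t.
  rewrite lerBlDl -powRM//; apply: le_trans (powR_subadditive _ _ _) => //.
  - by apply: ge0_ler_powR; rewrite ?nnegrE ?(ltW t0)//; lra.
  - by rewrite t0/= /t; lra.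
  - by rewrite mulr_ge0.
have [|x y /= /andP[x1 _] /andP[y1 _]|n cov nle] :=
  @coverable_lipschitz R R (spiral_pt p) (fun x => x `^ (1 - p))
  [set x | (1 < x) && (`|x `^ (- p) - a0| <= rho)] K _ _ r K0 r0 uv.
- move=> x /= /andP[x1]; rewrite ler_distl => /andP[xl xr].
  have -> : x `^ (1 - p) = (x `^ (- p)) `^ t.
    by rewrite -powRrM /t; congr (_ `^ _); field; rewrite gt_eqF.
  have xp := powR_ge0 x (- p).
  apply/andP; split; apply: ge0_ler_powR; rewrite ?nnegrE ?(ltW t0)//; last lra.
  by rewrite ge_max xp.
- by apply: lip; exact: ltW.
exists n.
  apply: coverableS cov => w [wz [x /= x1 wE]]; move: wz; rewrite -{w}wE => xz.
  exists x => //=; rewrite x1/=.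
  rewrite ler_distl; move: xz; rewrite /cball /mkset -zE => xz.
  have := le_normcD (spiral_pt p x - spiral_pt p x0) (spiral_pt p x0).
  have := le_normcD (spiral_pt p x0 - spiral_pt p x) (spiral_pt p x).
  rewrite !subrK -(opprB (spiral_pt p x) (spiral_pt p x0)) normcN.
  rewrite !normc_spiral_pt -/a0.
  by move=> ? ?; apply/andP; split; lra.
apply: (le_trans nle); rewrite lerD2r ler_pM2r ?invr_gt0// -mulrA.
by rewrite ler_wpM2l ?(ltW K0).
Qed.

End SpiralCounting.

(** * Separated points on the spiral and lower bounds for covering numbers *)

Section SpiralSeparation.
Context {R : realType}.
Implicit Types (p r x y X : R).

(** The difference of the moduli already exceeds [r]. The common bound [B] makes the threshold
    uniform over all chosen points. *)
Lemma spiral_pt_separated_turns p r x y B : 0 < p -> 0 < x -> y <= B -> 0 < y - x ->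
  r < p * B `^ (- p - 1) * (y - x) ->
  r < Normc.normc (spiral_pt p x - spiral_pt p y).
Proof.
move=> p0 x0 yB xy; have y0 : 0 < y by lra.
move=> /lt_le_trans; apply; have xy' : x <= y by lra.
apply: le_trans (_ : x `^ (- p) - y `^ (- p) <= _).
  apply: le_trans (powRN_decrement p0 x0 xy').
  rewrite ler_wpM2r ?(ltW xy)// ler_wpM2l ?(ltW p0)//.
  by apply: ler_powR_npos => //; lra.
rewrite lerBlDr -!normc_spiral_pt.
by have := le_normcD (spiral_pt p x - spiral_pt p y) (spiral_pt p y); rewrite subrK.
Qed.

(** Within one turn the moduli can be too close, so the angle separates: sin t >= t cos 1 on
    [0, 1]. *)
Lemma spiral_pt_separated_arc p r x y B : 0 < p -> 0 < y -> y <= B ->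
  0 <= y - x <= 1 -> r < B `^ (- p) * cos 1 * (y - x) ->
  r < Normc.normc (spiral_pt p x - spiral_pt p y).
Proof.
move=> p0 y0 yB xy /lt_le_trans; apply.
apply: le_trans (sin_dist_le_spiral_pt p x y).
apply: le_trans (_ : B `^ (- p) * sin (y - x) <= _).
  by rewrite -mulrA ler_wpM2l ?powR_ge0// cos1_mul_le_sin.
rewrite ler_wpM2r//; last by apply: ler_powR_npos => //; rewrite oppr_le0 ltW.
case/andP: xy => xy0 xy1; apply: le_trans (cos1_mul_le_sin _); last by rewrite xy0.
by rewrite mulr_ge0// ltW// cos1_gt0.
Qed.

(* The separated points have parameters X + 2 pi M i + h j: h moves by more than
   r along a turn, and M turns are needed to move by more than r across turns. *)
Lemma coverable_spiral_ge p : 0 < p ->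
  exists2 c, 0 < c & forall r X n, 0 < r -> 2 <= X ->
    coverable (cball (spiral_pt p X) (2 * X `^ (- p)) `&` spiral p) r n ->
    c * X `^ (1 - p) <= n%:R * (r * (1 + r * X `^ (p + 1))).
Proof.
move=> p0; have c1 := cos1_gt0 R; have pi2 := pi_ge2 R.
(* All chosen parameters are at most X + 2 pi X + 1 <= Q X. *)
pose Q : R := 2 + 2 * pi; have Q0 : 0 < Q by rewrite /Q; lra.
(* [C] and [D] match the two separation lemmas with B = Q X: p B^(-p-1) times C r X^(p+1) equals r,
   and B^(-p) cos 1 times D r X^p equals 2 r. *)
pose C := Q `^ (p + 1) / p; have C0 : 0 < C by rewrite divr_gt0 ?powR_gt0.
pose D := 2 * Q `^ p / cos 1.
have D0 : 0 < D by rewrite divr_gt0 ?mulr_gt0 ?powR_gt0.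
exists (((C + 1) * D)^-1); first by rewrite invr_gt0 mulr_gt0//; lra.
move=> r X n r0 X2 cov; have X0 : 0 < X by lra.
pose M : nat := (Num.truncn (C * r * X `^ (p + 1))).+1.
pose m : nat := (Num.truncn (X / M%:R)).+1.
pose h := D * r * X `^ p.
have h0 : 0 < h := mulr_gt0 (mulr_gt0 D0 r0) (powR_gt0 p X0).
pose q : nat := (Num.truncn h^-1).+1.
have M1 : 1 <= M%:R :> R by rewrite ler1n.
have M0 : 0 < M%:R :> R by rewrite ltr0n.
have MC : C * r * X `^ (p + 1) < M%:R by exact: truncnS_gt.
have MC' : M%:R <= C * r * X `^ (p + 1) + 1.
  rewrite -natr1 lerD2r truncn_le mulr_ge0 ?powR_ge0//.
  exact: ltW (mulr_gt0 C0 r0).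
have mX (i : 'I_m) : M%:R * i%:R <= X.
  rewrite mulrC -ler_pdivlMr//; apply: le_trans (_ : (Num.truncn (X / M%:R))%:R <= _).
    by rewrite ler_nat -ltnS.
  by rewrite truncn_le divr_ge0 ?ltW.
have qh (j : 'I_q) : h * j%:R <= 1.
  rewrite mulrC -ler_pdivlMr// div1r; apply: le_trans (_ : (Num.truncn h^-1)%:R <= _).
    by rewrite ler_nat -ltnS.
  by rewrite truncn_le invr_ge0 ltW.
pose x (k : 'I_m * 'I_q) : R := X + 2 * pi * (M%:R * k.1%:R) + h * k.2%:R.
have xX k : X <= x k.
  have := mulr_ge0 (ltW h0) (ler0n R k.2).
  have : 0 <= 2 * pi * (M%:R * k.1%:R) :> R by rewrite !mulr_ge0// pi_ge0.
  rewrite /x; lra.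
have xQ k : x k <= Q * X.
  have := mX k.1; have := qh k.2; rewrite /x /Q; move: (_ * _) (_ * _) => a b.
  by move=> ? ?; nra.
have sepT (k l : 'I_m * 'I_q) : (k.1 < l.1)%N ->
    r < Normc.normc (spiral_pt p (x k) - spiral_pt p (x l)).
  (* The offsets [h * j] stay in [0, 1], so a turn gap of at least 2 pi M leaves more than M. *)
  move=> kl; have Mxy : M%:R <= x l - x k.
    rewrite /x; have := qh k.2; have : 0 <= h * l.2%:R by rewrite mulr_ge0// ltW.
    have : M%:R * k.1%:R + M%:R <= M%:R * l.1%:R :> R.
      by rewrite -[X in _ + X <= _]mulr1 -mulrDr natr1 ler_pM2l// ler_nat.
    move: (M%:R * k.1%:R) (M%:R * l.1%:R) (h * _) (h * _) => a b c d; nra.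
  apply: (spiral_pt_separated_turns (B := Q * X)) => //.
  - exact: lt_le_trans (xX k).
  - exact: lt_le_trans Mxy.
  have Bp : 0 < p * (Q * X) `^ (- p - 1).
    by rewrite mulr_gt0 // powR_gt0 // mulr_gt0.
  apply: lt_le_trans (_ : p * (Q * X) `^ (- p - 1) * M%:R <= _); last first.
    by rewrite ler_pM2l.
  apply: le_lt_trans (_ : p * (Q * X) `^ (- p - 1) * (C * r * X `^ (p + 1)) < _); last first.
    by rewrite ltr_pM2l.
  rewrite -opprD powRN powRM ?(ltW Q0) ?(ltW X0)// /C.
  rewrite le_eqVlt; apply/orP; left; apply/eqP; field.
  by rewrite !gt_eqF ?powR_gt0.
have sepA (k l : 'I_m * 'I_q) : k.1 = l.1 -> (k.2 < l.2)%N ->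
    r < Normc.normc (spiral_pt p (x k) - spiral_pt p (x l)).
  move=> kl1 kl.
  have xkl : x l - x k = h * l.2%:R - h * k.2%:R by rewrite /x kl1; ring.
  have hxy : h <= x l - x k.
    rewrite xkl -mulrBr -[leLHS]mulr1 ler_pM2l// lerBrDr nat1r.
    by rewrite ler_nat.
  apply: (spiral_pt_separated_arc (B := Q * X)) => //.
  - exact: lt_le_trans (xX l).
  - rewrite (le_trans (ltW h0) hxy)/= xkl.
    have := qh l.2; have : 0 <= h * k.2%:R by rewrite mulr_ge0// ltW.
    lra.
  have Bp : 0 < (Q * X) `^ (- p) * cos 1.
    by rewrite mulr_gt0 // powR_gt0 // mulr_gt0.
  apply: lt_le_trans (_ : (Q * X) `^ (- p) * cos 1 * h <= _); last first.
    by rewrite ler_pM2l.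
  rewrite powRN powRM ?(ltW Q0) ?(ltW X0)// /h /D.
  rewrite (_ : _ * _ * _ = 2 * r); first lra.
  by field; rewrite !gt_eqF ?powR_gt0.
have sep (k l : 'I_m * 'I_q) : k != l -> r < Normc.normc (spiral_pt p (x k) - spiral_pt p (x l)).
  case: (ltngtP k.1 l.1) => [kl _|lk _|/val_inj kl1].
  - exact: sepT.
  - by rewrite -opprB normcN; exact: sepT.
  case: (ltngtP k.2 l.2) => [kl _|lk _|/val_inj kl2].
  - exact: sepA.
  - by rewrite -opprB normcN; exact: sepA.
  by case: k l kl1 kl2 => [? ?] [? ?] /= -> ->; rewrite eqxx.
have := card_separated_le _ sep cov.
rewrite card_prod !card_ord => /(_ _)/wrap[].
  move=> k; split; last first.
    by rewrite spiralE; exists (x k) => //=; apply: lt_le_trans (xX k); lra.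
  rewrite /cball /mkset; apply: (le_trans (le_normcD _ _)).
  rewrite normcN !normc_spiral_pt mulrDl mul1r lerD2r.
  by apply: ler_powR_npos => //; rewrite oppr_le0 ltW.
rewrite -(ler_nat R) natrM => mqn.
(* Thanks to the successors in [m] and [q], m M > X and q h > 1 hold even when a truncation is 0.
   Hence X <= n M h, where M h is at most a constant times (1 + r X^(p+1)) r X^p. *)
have mM : X < m%:R * M%:R by rewrite -ltr_pdivrMr// truncnS_gt.
have q1 : 1 < q%:R * h by rewrite -ltr_pdivrMr// div1r truncnS_gt.
rewrite powRB; last by rewrite (gt_eqF X0) implybT.
rewrite powRr1 ?(ltW X0)//.
set E := X `^ p; set F := X `^ (p + 1).
have E0 : 0 < E by exact: powR_gt0.
have F0 : 0 < F by exact: powR_gt0.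
have CD : 0 < (C + 1) * D by rewrite mulr_gt0//; lra.
rewrite mulrC ler_pdivrMr// ler_pdivrMr//.
have MC2 : M%:R <= (C + 1) * (1 + r * F).
  apply: (le_trans MC'); rewrite -/F; have : 0 < r * F by rewrite mulr_gt0.
  by rewrite -mulrA => ?; nra.
have -> : n%:R * (r * (1 + r * F)) * ((C + 1) * D) * E =
  n%:R * ((C + 1) * (1 + r * F)) * h by rewrite /h -/E; ring.
apply: le_trans (_ : (m%:R * M%:R) * (q%:R * h) <= _).
  rewrite -[leLHS]mulr1; apply: ler_pM => //; rewrite ?(ltW X0)//; exact: ltW.
rewrite mulrACA [leLHS]mulrA ler_pM2r//; apply: ler_pM => //.
Qed.

End SpiralSeparation.

(** * From covering counts to bounds on the Assouad spectrum *)

Section AssouadSpectrum.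
Context {R : realType}.
Implicit Types (F : set R[i]) (p r theta b : R).

Lemma powR_ratio r theta : 0 < r -> r `^ theta / r = r `^ (- (1 - theta)).
Proof.
move=> r0; rewrite opprB powRB; last by rewrite (gt_eqF r0) implybT.
by rewrite powRr1 ?ltW.
Qed.

Lemma powR_le_exponent (c c' b b' : R) : 0 < c -> 0 < c' ->
    (forall r, 0 < r < 1 -> c * r `^ (- b) <= c' * r `^ (- b')) ->
  b <= b'.
Proof.
move=> c0 c0' H; rewrite leNgt; apply/negP => bb.
pose d := b - b'; have d0 : 0 < d by rewrite subr_gt0.
(* [r] will satisfy r^d = q: the bound c/(2c') contradicts the hypothesis by a factor 2, and 1/2
   keeps r below 1. *)
pose q := Num.min (c / (2 * c')) 2^-1.
have q0 : 0 < q by rewrite lt_min invr_gt0 divr_gt0 ?mulr_gt0/=.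
have q1 : q < 1 by rewrite gt_min; apply/orP; right; lra.
pose r := q `^ (d^-1).
have r0 : 0 < r by exact: powR_gt0.
have r1 : r < 1.
  have : q `^ d^-1 < 1 `^ d^-1.
    by apply: gt0_ltr_powR; rewrite ?invr_gt0 ?nnegrE// ltW.
  by rewrite powR1.
have := H r; rewrite r0 r1 => /(_ isT).
rewrite (_ : - b' = d - b); last by rewrite /d; ring.
rewrite powRD; last by rewrite (gt_eqF r0) implybT.
rewrite mulrA ler_pM2r ?powR_gt0// -powRrM mulVf ?gt_eqF// powRr1 ?(ltW q0)//.
have : q <= c / (2 * c') by rewrite ge_min lexx.
rewrite ler_pdivlMr ?mulr_gt0// => h1 h2; nra.
Qed.

(** The infimum only has to be approached, so each excess [d] may have its own constant [c]. *)
Lemma assouad_spectrum_le theta F (a : R) : 0 <= a ->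
    (forall d, 0 < d -> exists2 c, 0 < c & forall r z, 0 < r < 1 -> F z ->
      exists2 n, coverable (cball z (r `^ theta) `&` F) r n &
        n%:R <= c * r `^ (- (1 - theta) * (a + d))) ->
  (assouad_spectrum theta F <= a%:E)%E.
Proof.
move=> a0 H; apply/lee_addgt0Pr => d d0; have [c c0 cH] := H d d0.
apply: ereal_inf_lbound; exists (a + d) => //; split; first by rewrite addr_ge0// ltW.
exists c => // r z r01 Fz; have [n cov nle] := cH r z r01 Fz.
apply: le_trans (covering_number_le cov) _.
by rewrite lee_fin powR_ratio -?powRrM//; case/andP: r01.
Qed.

(** One ball per scale suffices, with a centre depending on r: letting r tend to 0, every admissible
    exponent a satisfies b <= (1 - theta) a. *)
Lemma assouad_spectrum_ge theta F b : theta < 1 ->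
    (exists2 c, 0 < c & forall r, 0 < r < 1 -> exists2 z, F z &
      forall n, coverable (cball z (r `^ theta) `&` F) r n ->
        c * r `^ (- b) <= n%:R) ->
  ((b / (1 - theta))%:E <= assouad_spectrum theta F)%E.
Proof.
move=> t1 [c c0 H]; apply: le_ereal_inf_tmp => _ [a [a0 [c' c0' aH]] <-].
rewrite lee_fin ler_pdivrMr ?subr_gt0// mulrC.
apply: (powR_le_exponent c0 c0') => r r01; have [z Fz zH] := H r r01.
rewrite -mulNr powRrM -powR_ratio; last by case/andP: r01.
rewrite -lee_fin; apply: le_trans (aH r z r01 Fz).
by apply: covering_number_ge => n /zH; rewrite lee_fin.
Qed.

(** At X = K r^-eta, the condition theta/p <= eta puts the ball of radius 2 X^-p inside radius
    r^theta. The two bounds on [b] are the exponents of the counts X^(1-p)/r, for turns more than r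
    apart, and X^(-2p)/r^2, for closer turns. *)
Lemma assouad_spectrum_spiral_ge p theta eta b :
    0 < p -> 0 < theta < 1 -> theta / p <= eta ->
    b <= 1 + eta * (1 - p) -> b <= 2 - 2 * eta * p ->
  ((b / (1 - theta))%:E <= assouad_spectrum theta (spiral p))%E.
Proof.
move=> p0 /andP[t0 t1] te b1 b2; apply: assouad_spectrum_ge => //.
have eta0 : 0 <= eta by apply: le_trans te; rewrite divr_ge0 ?ltW.
have [c c0 cH] := @coverable_spiral_ge R p p0.
(* The factor 2^(1/p) gives 2 K^-p <= 1, which absorbs the 2 in the radius; the leading 2 ensures X
   >= 2. *)
pose K : R := 2 * 2 `^ p^-1.
have K2 : 2 <= K by rewrite /K ler_peMr// powR_ge1 ?invr_ge0 ?ltW//; lra.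
have K0 : 0 < K by lra.
have Kp : K `^ (- p) <= 2^-1.
  rewrite powRN lef_pV2 ?posrE ?powR_gt0// powRM ?powR_ge0//.
  rewrite -powRrM mulVf ?gt_eqF// powRr1// ler_peMl// powR_ge1 ?ltW//; lra.
have Kp1 : 0 < K `^ (p + 1) by exact: powR_gt0.
have K1p : 0 < K `^ (1 - p) by exact: powR_gt0.
exists (c * K `^ (1 - p) / (1 + K `^ (p + 1))).
  by rewrite divr_gt0 ?mulr_gt0//; lra.
move=> r /andP[r0 r1]; pose X := K * r `^ (- eta).
have rle u v : v <= u -> r `^ u <= r `^ v by apply: ger_powR; rewrite r0 ltW.
have re1 : 1 <= r `^ (- eta) by rewrite -[leLHS](powRr0 r) rle// oppr_le0.
have X2 : 2 <= X by rewrite /X; nra.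
have rD u v : r `^ (u + v) = r `^ u * r `^ v.
  by rewrite powRD// (gt_eqF r0) implybT.
have XE u : X `^ u = K `^ u * r `^ (- eta * u).
  by rewrite powRM ?powR_ge0 ?(ltW K0)// -powRrM.
exists (spiral_pt p X); first by rewrite spiralE; exists X => //=; lra.
move=> n cov; have /(cH r X n r0 X2) : coverable
    (cball (spiral_pt p X) (2 * X `^ (- p)) `&` spiral p) r n.
  apply: coverableS cov; apply: setSI => w; rewrite /cball /mkset.
  move=> /le_trans; apply; rewrite XE mulrNN.
  have : r `^ (eta * p) <= r `^ theta by rewrite rle// -ler_pdivrMr.
  have := powR_ge0 r (eta * p); nra.
rewrite !XE; set Y := r `^ (1 - eta * (p + 1)).
have -> : r * (K `^ (p + 1) * r `^ (- eta * (p + 1))) = K `^ (p + 1) * Y.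
  by rewrite /Y rD powRr1 ?(ltW r0)// mulNr mulrCA.
set W := r `^ (- eta * (1 - p) - 1).
have -> : r `^ (- eta * (1 - p)) = W * r.
  by rewrite -{2}(powRr1 (ltW r0)) -rD; congr (_ `^ _); ring.
have Y0 : 0 < Y by exact: powR_gt0.
(* The two conditions on [b] yield [bW] and [bYW]; added, they bound r^-b (1 + k2 Y) by W (1 + k2),
   whichever of 1 and k2 Y dominates. *)
have bW : r `^ (- b) <= W by rewrite rle//; lra.
have bYW : r `^ (- b) * Y <= W by rewrite -rD rle//; nra.
set k1 := K `^ (1 - p); set k2 := K `^ (p + 1).
have k20 : 0 < k2 by exact: powR_gt0.
have ck1 : 0 < c * k1 by rewrite mulr_gt0// powR_gt0.
have Yk : 0 < 1 + k2 * Y by rewrite ltr_wpDr ?mulr_ge0 ?ltW.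
rewrite (_ : c * (k1 * (W * r)) = c * k1 * W * r); last by ring.
rewrite (_ : n%:R * _ = n%:R * (1 + k2 * Y) * r); last by ring.
rewrite ler_pM2r// => H; rewrite mulrAC ler_pdivrMr; last lra.
rewrite -(ler_pM2r Yk); apply: le_trans (_ : c * k1 * W * (1 + k2) <= _).
  by rewrite -!(mulrA (c * k1)) ler_pM2l//; nra.
by rewrite [leRHS]mulrAC ler_pM2r//; lra.
Qed.

(** The ball is covered as a planar set: with u = r^-(1-theta) >= 1, the count (4u + 1)^2 is at most
    25 u^2. *)
Lemma assouad_spectrum_le2 F theta : 0 < theta < 1 ->
  (assouad_spectrum theta F <= 2%:E)%E.
Proof.
move=> /andP[t0 t1]; apply: assouad_spectrum_le => // d d0.
exists 25 => // r z /andP[r0 r1] _.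
have [n cov nle] := coverable_cball z (powR_ge0 r theta) r0.
exists n; first by apply: coverableS cov; exact: subIsetl.
apply: (le_trans nle); rewrite -mulrA powR_ratio//.
set u := r `^ _; have u1 : 1 <= u.
  rewrite /u -[leLHS](powRr0 r); apply: ger_powR; first by rewrite r0 ltW.
  lra.
apply: le_trans (_ : 25 * u ^+ 2 <= _); first by rewrite -subr_ge0; nra.
rewrite ler_pM2l// powRrM -/u -powR_mulrn; last lra.
by rewrite ler_powR// lerDl ltW.
Qed.

Lemma assouad_spectrum_spiral_le_box p theta : 0 < p <= 1 -> 0 < theta < 1 ->
  (assouad_spectrum theta (spiral p) <= (2 / ((1 + p) * (1 - theta)))%:E)%E.
Proof.
move=> /andP[p0 p1] /andP[t0 t1].
have q0 : 0 < (1 + p) * (1 - theta) by rewrite mulr_gt0; lra.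
apply: assouad_spectrum_le; first by rewrite divr_ge0// ltW.
move=> d d0; have e0 : 0 < (1 + p) * (1 - theta) * d by rewrite mulr_gt0.
(* This [s] makes (1 + s + p)/(1 + p) equal to (1 - theta)(a + d) with a = 2/((1 + p)(1 - theta)),
   and the excess [d] keeps it positive at p = 1. *)
have [||K K0 KH] := @coverable_spiral R p (1 - p + (1 + p) * (1 - theta) * d) p0.
- lra.
- lra.
exists K => // r z r01 _; have [n cov nle] := KH r r01.
exists n; first by apply: coverableS cov; exact: subIsetr.
apply: (le_trans nle); rewrite le_eqVlt; apply/orP; left; apply/eqP.
by congr (_ * _ `^ _); field; apply/andP; split; lra.
Qed.

Lemma assouad_spectrum_spiral_le_length p theta : 1 < p -> 0 < theta < 1 ->
  (assouad_spectrum theta (spiral p) <= (1 + theta / (p * (1 - theta)))%:E)%E.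
Proof.
move=> p1 /andP[t0 t1]; have [K K0 KH] := @coverable_cball_spiral R p p1.
have p0 : 0 < p by lra.
have q0 : 0 < theta / (p * (1 - theta)) by rewrite divr_gt0// mulr_gt0//; lra.
apply: assouad_spectrum_le; first lra.
move=> d d0; exists (K + 1); first lra.
move=> r z /andP[r0 r1] zp; have [n cov nle] := KH r _ z r0 (powR_ge0 r theta) zp.
exists n => //; apply: (le_trans nle).
have rle u v : v <= u -> r `^ u <= r `^ v by apply: ger_powR; rewrite r0 ltW.
rewrite mulrDl mul1r; apply: lerD; last first.
  by rewrite -[leLHS](powRr0 r) rle//; nra.
rewrite -mulrA ler_pM2l// -powRrM.
have -> : r `^ (theta * (1 - p^-1)) / r = r `^ (theta * (1 - p^-1) - 1).
  by rewrite powRB ?(gt_eqF r0) ?implybT// powRr1 ?(ltW r0).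
apply: rle.
have -> : theta * (1 - p^-1) - 1 =
    - (1 - theta) * (1 + theta / (p * (1 - theta))).
  by field; apply/andP; split; lra.
by rewrite !mulNr lerN2 ler_pM2l; lra.
Qed.

(** With eta = theta/p the turns near X are about r^(theta (1+p)/p) apart, which past the transition
    is at most r, so the count is that of a full disc. *)
Lemma assouad_spectrum_spiral_ge2 p theta : 0 < p -> 0 < theta < 1 ->
  p / (1 + p) <= theta -> (2%:E <= assouad_spectrum theta (spiral p))%E.
Proof.
move=> p0 t01; have /andP[t0 t1] := t01.
rewrite ler_pdivrMr; last lra.
move=> pt; have h := divfK (lt0r_neq0 p0) theta.
have := @assouad_spectrum_spiral_ge p theta (theta / p) (2 * (1 - theta)) p0 t01.
rewrite mulfK; last lra.
move: (theta / p) h => q h; apply; first exact: lexx.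
- by rewrite -h in pt *; nra.
- by rewrite -mulrA h; lra.
Qed.

(** With eta = 1/(1+p) the turns near X are about r apart, and both conditions on [b] become
    equalities. *)
Lemma assouad_spectrum_spiral_ge_box p theta : 0 < p -> 0 < theta < 1 ->
  theta <= p / (1 + p) ->
  ((2 / ((1 + p) * (1 - theta)))%:E <= assouad_spectrum theta (spiral p))%E.
Proof.
move=> p0 t01 tp; have /andP[t0 t1] := t01.
have := @assouad_spectrum_spiral_ge p theta (1 + p)^-1 (2 / (1 + p)) p0 t01.
rewrite (_ : 2 / (1 + p) / (1 - theta) = 2 / ((1 + p) * (1 - theta))); last first.
  by field; apply/andP; split; lra.
apply.
- by rewrite ler_pdivrMr// mulrC.
- rewrite le_eqVlt; apply/orP; left; apply/eqP; field; lra.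
- rewrite le_eqVlt; apply/orP; left; apply/eqP; field; lra.
Qed.

(** With eta = theta/p below the transition, the turns near X are at least about r apart, so the
    total length X^(1-p) over r is counted. *)
Lemma assouad_spectrum_spiral_ge_length p theta : 0 < p -> 0 < theta < 1 ->
  theta <= p / (1 + p) ->
  ((1 + theta / (p * (1 - theta)))%:E <= assouad_spectrum theta (spiral p))%E.
Proof.
move=> p0 t01 tp; have /andP[t0 t1] := t01.
have := @assouad_spectrum_spiral_ge p theta (theta / p) (1 + theta / p - theta) p0 t01.
rewrite (_ : _ / (1 - theta) = 1 + theta / (p * (1 - theta))); last first.
  by field; apply/andP; split; lra.
have h := divfK (lt0r_neq0 p0) theta.
move: tp; rewrite ler_pdivlMr; last lra.
move=> tp; apply => //; first by rewrite mulrBr h; lra.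
by move: h; set q := theta / p => h; nra.
Qed.

End AssouadSpectrum.

(** * Exact spectrum, phase transition, box and quasi-Assouad dimensions *)

Section SpiralTheorem.
Context {R : realType}.
Implicit Types (p theta t : R).

Lemma assouad_spectrum_spiral_le1 p theta : 0 < p <= 1 -> 0 < theta < 1 ->
  assouad_spectrum theta (spiral p) =
  (Num.min (2 / ((1 + p) * (1 - theta))) 2)%:E.
Proof.
move=> p01 t01; have /andP[p0 _] := p01; apply/eqP; rewrite eq_le; apply/andP; split.
  by rewrite minElt; case: ifP => _;
    [exact: assouad_spectrum_spiral_le_box|exact: assouad_spectrum_le2].
have [tp|/ltW pt] := leP theta (p / (1 + p)).
  apply: le_trans (assouad_spectrum_spiral_ge_box p0 t01 tp).
  by rewrite lee_fin ge_min lexx.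
apply: le_trans (assouad_spectrum_spiral_ge2 p0 t01 pt).
by rewrite lee_fin ge_min lexx orbT.
Qed.

Lemma assouad_spectrum_spiral_ge1 p theta : 1 <= p -> 0 < theta < 1 ->
  assouad_spectrum theta (spiral p) =
  (Num.min (1 + theta / (p * (1 - theta))) 2)%:E.
Proof.
rewrite le_eqVlt => /predU1P[<- t01|p1 t01].
  (* At p = 1 the two formulas agree, since 1/(1 - theta) = 1 + theta/(1 - theta). *)
  rewrite assouad_spectrum_spiral_le1 ?ltr01 ?lexx//.
  congr (Num.min _ _)%:E; case/andP: t01 => t0 t1; field; lra.
have p0 : 0 < p by lra.
apply/eqP; rewrite eq_le; apply/andP; split.
  by rewrite minElt; case: ifP => _;
    [exact: assouad_spectrum_spiral_le_length|exact: assouad_spectrum_le2].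
have [tp|/ltW pt] := leP theta (p / (1 + p)).
  apply: le_trans (assouad_spectrum_spiral_ge_length p0 t01 tp).
  by rewrite lee_fin ge_min lexx.
apply: le_trans (assouad_spectrum_spiral_ge2 p0 t01 pt).
by rewrite lee_fin ge_min lexx orbT.
Qed.

(** Both spectrum formulas have the shape a + b/(1 - t), increasing through 2 at [tau]. Off [tau], f
    is locally a differentiable function; at [tau] the two one-sided difference quotients stay
    apart. *)
Lemma phase_transition_min (f : R -> R) (a b tau : R) :
    0 < b -> 0 < tau < 1 -> a + b / (1 - tau) = 2 ->
    (forall t, 0 < t < 1 -> f t = Num.min (a + b / (1 - t)) 2) ->
  [set t | 0 < t < 1 /\ ~ derivable f t 1] = [set tau].
Proof.
move=> b0 /andP[tau0 tau1] ab fE.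
have gle t : t <= tau -> a + b / (1 - t) <= 2.
  by move=> tt; rewrite -ab lerD2l ler_pM2l// lef_pV2 ?posrE; lra.
have gge t : tau <= t -> t < 1 -> 2 <= a + b / (1 - t).
  by move=> tt t1; rewrite -ab lerD2l ler_pM2l// lef_pV2 ?posrE; lra.
apply/seteqP; split=> [t [/andP[t0 t1] fN]|_ ->] /=.
  have [tt|tt|//] := ltgtP t tau; exfalso; apply: fN.
    apply: (@near_eq_derivable _ _ _ (fun t => a + b / (1 - t))).
      near=> s; rewrite fE ?(min_idPl _) ?gle//.
        by apply: ltW; near: s; exact: lt_nbhsl.
      apply/andP; split; first by near: s; exact: lt_nbhsr.
      by near: s; exact: lt_nbhsl.
    apply: derivableD; first exact: derivable_cst.
    apply: derivableM; first exact: derivable_cst.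
    apply: derivableV; first by rewrite subr_eq0 gt_eqF.
    by apply: derivableB; [exact: derivable_cst|exact: derivable_id].
  apply: (@near_eq_derivable _ _ _ (fun=> 2 : R)); last exact: derivable_cst.
  near=> s; have s1 : s < 1 by near: s; exact: lt_nbhsl.
  have ts : tau < s by near: s; exact: lt_nbhsr.
  by rewrite fE ?s1 ?(lt_trans tau0)// (min_idPr _)// gge// ltW.
split; first exact/andP.
move=> /cvg_ex[l /= fl].
have ftau : f tau = 2 by rewrite fE ?tau0// ab minxx.
(* Right quotients are 0 and left quotients are at least b/(1 - tau); [e] is half that gap, so l < e
   and l > e would both follow. *)
pose e := b / (1 - tau) / 2.
have e0 : 0 < e by rewrite !divr_gt0// subr_gt0.
have /cvgrPdist_lt/(_ e e0) rl := cvg_dnbhs_at_right fl.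
have /cvgrPdist_lt/(_ e e0) ll := cvg_dnbhs_at_left fl.
have l1 : l < e.
  have [h [/=]] : exists h : R, [/\ `|l - h^-1 *: (f (h *: 1 + tau) - f tau)| < e,
      0 < h & h < 1 - tau].
    apply: (@filter_ex _ (0 : R)^'+); near=> h; split; first by near: h.
      by near: h; exact: nbhs_right_gt.
    by near: h; apply: nbhs_right_lt; rewrite subr_gt0.
  rewrite ftau [h *: 1]mulr1 => + h0 h1; rewrite fE ?(min_idPr _); last 2 first.
  - by apply: gge; lra.
  - by apply/andP; split; lra.
  by rewrite subrr scaler0 subr0 => /(le_lt_trans (ler_norm _)).
have [h [/=]] : exists h : R, [/\ `|l - h^-1 *: (f (h *: 1 + tau) - f tau)| < e,
    h < 0 & - tau < h].
  apply: (@filter_ex _ (0 : R)^'-); near=> h; split; first by near: h.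
    by near: h; exact: nbhs_left_lt.
  by near: h; apply: nbhs_left_gt; rewrite oppr_lt0.
rewrite ftau [h *: 1]mulr1 => + h0 h1; rewrite fE ?(min_idPl _); last 2 first.
- by apply: gle; lra.
- by apply/andP; split; lra.
rewrite -ab (_ : h^-1 *: _ = b / (1 - tau) / (1 - tau - h)); last first.
  rewrite /GRing.scale/=; field; apply/and3P; split; lra.
have : b / (1 - tau) <= b / (1 - tau) / (1 - tau - h).
  have q0 : 0 <= b / (1 - tau) by apply: divr_ge0; lra.
  have q1 : 1 <= (1 - tau - h)^-1 by rewrite invf_ge1; lra.
  exact: ler_peMr.
rewrite ltr_distl => ? /andP[+ _]; move: e0 l1; rewrite /e; lra.
Unshelve. all: by end_near. Qed.

Lemma phase_transitions_spiral p : 0 < p ->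
  phase_transitions (spiral p) = [set p / (1 + p)].
Proof.
move=> p0; have tau01 : 0 < p / (1 + p) < 1.
  by rewrite divr_gt0 ?ltr_pdivrMr; lra.
have [p1|/ltW p1] := leP p 1.
  apply: (@phase_transition_min _ 0 (2 / (1 + p)) _ _ tau01).
  - by rewrite divr_gt0; lra.
  - by field; apply/andP; split; lra.
  move=> t t01; rewrite assouad_spectrum_spiral_le1 ?p0//= add0r.
  by congr (Num.min _ _); case/andP: t01 => t0 t1; field; apply/andP; split; lra.
(* As t/(1 - t) = 1/(1 - t) - 1, the formula for p >= 1 is (1 - 1/p) + (1/p)/(1 - t). *)
apply: (@phase_transition_min _ (1 - p^-1) (p^-1) _ _ tau01).
- by rewrite invr_gt0.
- by field; apply/andP; split; lra.
move=> t t01; rewrite assouad_spectrum_spiral_ge1//=.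
by congr (Num.min _ _); case/andP: t01 => t0 t1; field; apply/andP; split; lra.
Qed.

Lemma upper_box_dim_ge (F : set R[i]) (c b : R) : 0 < c ->
    (forall r n, 0 < r < 1 -> coverable F r n -> c * r `^ (- b) <= n%:R) ->
  (b%:E <= upper_box_dim F)%E.
Proof.
move=> c0 H; apply/lee_addgt0Pr => e e0.
rewrite -leeBlDr// -EFinB; apply: le_ereal_inf_tmp => _ [V V0 <-].
(* For r < d, |ln c| < e (- ln r), so the constant [c] shifts the quotient by less than [e]. *)
pose d := expR (- (`|ln c| / e)).
have [r [Vr r0 rd r1]] : exists r : R, [/\ V r, 0 < r, r < d & r < 1].
  apply: (@filter_ex _ (0 : R)^'+); near=> r; split; first by near: r.
  - by near: r; exact: nbhs_right_gt.
  - by near: r; apply: nbhs_right_lt; exact: expR_gt0.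
  - by near: r; exact: nbhs_right_lt.
apply: le_trans (ereal_sup_ubound _); last by exists r.
have lr : 0 < - ln r by rewrite oppr_gt0 ln_lt0 ?r0.
have rbc : 0 < c * r `^ (- b) by rewrite mulr_gt0 ?powR_gt0.
apply: (@le_trans _ _ (lne (c * r `^ (- b))%:E * ((- ln r)^-1)%:E)%E); last first.
  apply: lee_wpmul2r; first by rewrite lee_fin invr_ge0 ltW.
  have cn : ((c * r `^ (- b))%:E <= covering_number r F)%E.
    by apply: covering_number_ge => n cov; rewrite lee_fin H// r0.
  have c0' : (0 <= (c * r `^ (- b))%:E)%E by rewrite lee_fin ltW.
  by rewrite lee_lne ?in_itv/= ?leey ?andbT// (le_trans c0').
rewrite lne_EFin// -EFinM lee_fin lnM ?posrE ?powR_gt0// ln_powR.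
rewrite ler_pdivlMr//.
have : ln r < - (`|ln c| / e) by rewrite -[ltRHS]expRK ltr_ln ?posrE ?expR_gt0.
rewrite ltrNr ltr_pdivrMr// => h; have := ler_norm (- ln c); rewrite normrN.
nra.
Unshelve. all: by end_near. Qed.

(** At the fixed parameter X = 2 the count is already a constant over r, as for any arc. This bound
    is enough for the strict inequality when p > 1. *)
Lemma upper_box_dim_spiral_ge1 p : 0 < p -> (1%:E <= upper_box_dim (spiral p))%E.
Proof.
move=> p0; have [c c0 cH] := @coverable_spiral_ge R p p0.
pose k : R := 2 `^ (p + 1); have k0 : 0 < k by exact: powR_gt0.
have K0 : 0 < c * 2 `^ (1 - p) by rewrite mulr_gt0 ?powR_gt0.
apply: (@upper_box_dim_ge _ (c * 2 `^ (1 - p) / (1 + k))).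
  by rewrite divr_gt0//; lra.
move=> r n /andP[r0 r1] cov.
have /(cH r 2 n r0 (lexx _)) : coverable
    (cball (spiral_pt p 2) (2 * 2 `^ (- p)) `&` spiral p) r n.
  by apply: coverableS cov; exact: subIsetr.
rewrite -/k powR_inv1 ?(ltW r0)// mulrAC ler_pdivrMr ?ltr_pwDl ?(ltW k0)// => h.
rewrite ler_pdivrMr//; apply: (le_trans h); rewrite -mulrA ler_wpM2l//.
by rewrite mulrC ler_pM2r//; nra.
Qed.

Lemma quasi_assouad_dim_spiral p : 0 < p -> quasi_assouad_dim (spiral p) = 2%:E.
Proof.
move=> p0; apply: lim_near_cst => //; near=> t.
have t1 : t < 1 by near: t; exact: nbhs_left_lt.
have pt : p / (1 + p) < t.
  by near: t; apply: nbhs_left_gt; rewrite ltr_pdivrMr; lra.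
have t0 : 0 < t by apply: lt_trans pt; rewrite divr_gt0; lra.
apply/eqP; rewrite eq_le assouad_spectrum_le2 ?t0//=.
by apply: assouad_spectrum_spiral_ge2; rewrite ?t0//; exact: ltW.
Unshelve. all: by end_near. Qed.

End SpiralTheorem.

Theorem theorem4p4 (R : realType) :
  [/\ forall p theta : R, 0 < p < 1 -> 0 < theta < 1 ->
        assouad_spectrum theta (spiral p)
        = (Num.min (2 / ((1 + p) * (1 - theta))) 2)%:E,
      forall p theta : R, 1 <= p -> 0 < theta < 1 ->
        assouad_spectrum theta (spiral p)
        = (Num.min (1 + theta / (p * (1 - theta))) 2)%:E,
      forall p : R, 0 < p ->
        phase_transitions (spiral p) = [set p / (1 + p)]
    & forall p theta : R, 1 < p -> 0 < theta < p / (1 + p) ->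
        (assouad_spectrum theta (spiral p)
         < Order.min (upper_box_dim (spiral p) * ((1 - theta)^-1)%:E)
                     (quasi_assouad_dim (spiral p)))%E].
Proof.
split.
- by move=> p theta /andP[p0 p1]; apply: assouad_spectrum_spiral_le1; rewrite p0 ltW.
- exact: assouad_spectrum_spiral_ge1.
- exact: phase_transitions_spiral.
move=> p theta p1 /andP[t0]; have p0 : 0 < p by lra.
rewrite ltr_pdivlMr; last lra.
move=> tp; have t1 : theta < 1 by nra.
have pt : 0 < p * (1 - theta) by rewrite mulr_gt0// subr_gt0.
rewrite assouad_spectrum_spiral_ge1 ?t0 ?ltW// quasi_assouad_dim_spiral//.
rewrite lt_min; apply/andP; split; last first.
  rewrite lte_fin gt_min (_ : 2 = 1 + 1)// ltrD2l ltr_pdivrMr//.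
  by apply/orP; left; nra.
(* The box dimension is replaced by its lower bound 1; the remaining gap is theta (p - 1)/(p (1 -
   theta)), positive because p > 1. *)
apply: (@lt_le_trans _ _ (1%:E * ((1 - theta)^-1)%:E)%E); last first.
  apply: lee_wpmul2r; last exact: upper_box_dim_spiral_ge1.
  by rewrite lee_fin invr_ge0 subr_ge0 ltW.
rewrite -EFinM mul1r lte_fin gt_min; apply/orP; left.
rewrite -subr_gt0 (_ : _ - _ = theta * (p - 1) / (p * (1 - theta))).
  by rewrite divr_gt0// mulr_gt0// subr_gt0.
by field; apply/andP; split; lra.
Qed.
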